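(* Let $n\ge3$. Then the boundary of $\mathcal{P}^n_{loc}$ in $\mathbb{R}^n$ is contained in the union of the following three irreducible algebraic varieties in $\mathbb{R}^n$ (with coordinates $a_1,\dots,a_n$): the hyperplanes $$\Pi^+:\quad a_1+2a_2+\dots+na_n=0,\qquad \Pi^-:\quad a_1-2a_2+\dots+(-1)^{n-1}na_n=0$$ (that is, $P'(1)=0$ and $P'(-1)=0$ for $P(z)=\sum_{j=1}^na_jz^j$), and the algebraic surface of order $n-2$ given by $$\mathcal{A}:\quad V_{n-1}(a_1,2a_2,\dots,na_n)=0.$$
   Context: $\mathbb{D}$ is the open unit disk in $\mathbb{C}$. For $j\ge1$, let $\mathcal{P}_{j,loc}(\overline{\mathbb{D}})$ be the class of polynomials $P(z)=a_1z+\dots+a_jz^j$ of degree $j$ with real coefficients, $a_1>0$, that are locally univalent on the closed unit disk, i.e. $P'(z)\ne0$ for all $z\in\overline{\mathbb{D}}$. Put $\mathcal{P}^n_{loc}=\bigcup_{1\le j\le n}\mathcal{P}_{j,loc}(\overline{\mathbb{D}})$. A polynomial $P(z)=\sum_{j=1}^na_jz^j$ is identified with the point $(a_1,\dots,a_n)\in\mathbb{R}^n$, so $\mathcal{P}^n_{loc}\subset\mathbb{R}^n$. For $m\ge2$, $V_m(A_0,A_1,\dots,A_m)$ denotes the homogeneous polynomial in $A_0,\dots,A_m$ determined by $$V_m(A_0,\dots,A_m)=A_m^{m-1}\prod_{1\le i<j\le m}(\alpha_i\alpha_j-1)\qquad\text{whenever }A_m\ne0,$$ where $\alpha_1,\dots,\alpha_m$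 are the roots, counted with multiplicity, of $A(z)=A_0+A_1z+\dots+A_mz^m$. An irreducible algebraic variety (hypersurface) here means the zero set of a polynomial that is irreducible over $\mathbb{C}$; its order is the degree of that polynomial. *)

(* Defs.v *)
From HB Require Import structures.
From mathcomp Require Import all_boot all_order all_algebra.
From mathcomp Require Import complex mpoly.
From mathcomp Require Import all_classical all_reals all_analysis.

Set Implicit Arguments.
Unset Strict Implicit.
Unset Printing Implicit Defensive.

Import Order.TTheory GRing.Theory Num.Theory.
Import numFieldNormedType.Exports.
Local Open Scope classical_set_scope.
Local Open Scope ring_scope.

Definition boundary (T : topologicalType) (A : set T) : set T :=
  closure A `\` A^°.

(* a_1 z + ... + a_n z^n; a_j is the entry of index j - 1 of the row a. *)
Definition poly_of (R : realType) (n : nat) (a : 'rV[R]_n) : {poly R} :=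
  \sum_(i < n) a 0 i *: 'X^(i.+1).

Definition loc_univalent_deg (R : realType) (j : nat) (P : {poly R}) : Prop :=
  [/\ size P = j.+1, P`_0 = 0, 0 < P`_1 &
      forall z : R[i], `|z| <= 1 -> (map_poly (real_complex R) P^`()).[z] != 0].

Definition Ploc (R : realType) (n : nat) : set 'rV[R]_n :=
  \bigcup_(j in [set j | (1 <= j <= n)%N])
    [set a | loc_univalent_deg j (poly_of a)].
Arguments Ploc R n : clear implicits.

Definition irreducible_elt (D : idomainType) (p : D) : Prop :=
  [/\ p != 0, p \isn't a GRing.unit &
      forall q r : D, p = q * r -> q \is a GRing.unit \/ r \is a GRing.unit].

Definition irreducible_of_order (R : realType) (n d : nat)
    (p : {mpoly R[n]}) : Prop :=
  irreducible_elt (map_mpoly (real_complex R) p) /\ msize p = d.+1.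

Definition zero_set (R : realType) (n : nat) (p : {mpoly R[n]}) :
    set 'rV[R]_n :=
  [set a | p.@[fun i => a 0 i] = 0].

(* The variable of index k of V stands for A_k, 0 <= k <= m. The sequence
   alpha lists the roots of A_0 + ... + A_m z^m with multiplicity. *)
Definition is_V (R : realType) (m : nat) (V : {mpoly R[m.+1]}) : Prop :=
  (exists d : nat, V \is d.-homog) /\
  forall (A : 'I_m.+1 -> R[i]) (alpha : 'I_m -> R[i]),
    A ord_max != 0 ->
    \sum_(k < m.+1) A k *: 'X^k
      = A ord_max *: \prod_(i < m) ('X - (alpha i)%:P) ->
    (map_mpoly (real_complex R) V).@[A]
      = A ord_max ^+ m.-1
        * \prod_(i < m) \prod_(j < m | (i < j)%N) (alpha i * alpha j - 1).

Definition Pi_plus (R : realType) (n : nat) : {mpoly R[n]} :=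
  \sum_(i < n) i.+1%:R *: 'X_i.

Definition Pi_minus (R : realType) (n : nat) : {mpoly R[n]} :=
  \sum_(i < n) ((-1) ^+ i * i.+1%:R) *: 'X_i.

(* V (a_1, 2 a_2, ..., n a_n) as a polynomial in a_1, ..., a_n; the cast
   identifies the indices in 'I_(n.-1.+1) with those in 'I_n. *)
Definition surfaceA (R : realType) (n : nat) (n_ge3 : (3 <= n)%N)
    (V : {mpoly R[n.-1.+1]}) : {mpoly R[n]} :=
  V \mPo [tuple i.+1%:R *: 'X_(cast_ord (ltn_predK n_ge3) i)
         | i < n.-1.+1].

Lemma deriv_poly_of (R : realType) (n : nat) (a : 'rV[R]_n) (x : R) :
  (poly_of a)^`().[x] = \sum_(i < n) a 0 i * i.+1%:R * x ^+ i.
Proof.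
rewrite /poly_of raddf_sum horner_sum; apply: eq_bigr => i _.
by rewrite /= derivZ derivXn hornerZ hornerMn hornerXn /= -mulr_natl mulrA.
Qed.

Lemma zero_Pi_plus (R : realType) (n : nat) (a : 'rV[R]_n) :
  zero_set (Pi_plus R n) a <-> (poly_of a)^`().[1] = 0.
Proof.
rewrite deriv_poly_of /zero_set /Pi_plus /= raddf_sum /=.
under [in X in _ <-> X]eq_bigr => i _ do rewrite expr1n mulr1 mulrC.
by under eq_bigr => i _ do rewrite mevalZ mevalXU.
Qed.

Lemma zero_Pi_minus (R : realType) (n : nat) (a : 'rV[R]_n) :
  zero_set (Pi_minus R n) a <-> (poly_of a)^`().[-1] = 0.
Proof.
rewrite deriv_poly_of /zero_set /Pi_minus /= raddf_sum /=.
under [in X in _ <-> X]eq_bigr => i _ do rewrite mulrC (mulrC (a _ _)) mulrA.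
by under eq_bigr => i _ do rewrite mevalZ mevalXU.
Qed.

(* Main.v *)
Require Import Defs.
From HB Require Import structures.
From mathcomp Require Import all_boot all_order all_algebra.
From mathcomp Require Import complex mpoly.
From mathcomp Require Import fingroup perm zify ring lra.
From mathcomp Require Import all_classical all_reals all_analysis.

Set Implicit Arguments.
Unset Strict Implicit.
Unset Printing Implicit Defensive.

Import Order.TTheory GRing.Theory Num.Theory.
Import numFieldNormedType.Exports.
Local Open Scope classical_set_scope.
Local Open Scope ring_scope.

(** Write m = n - 1, and A = P' = A_0 + ... + A_m z^m for P in R^n, so that
    A_k = (k+1) a_{k+1}.

    Existence and degree of V. The product of all alpha_i alpha_j - 1, i <
    j, is symmetric, hence a polynomial T in the coefficients of the monic
    polynomial with roots alpha ([pair_prod_coefs]). The degree of T is at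
    most m - 1: when one root x moves and the others are fixed, the
    coefficients run along an affine line, whose direction is essentially
    arbitrary, while the product has degree m - 1 in x
    ([msize_pair_prod_coefs]). Homogenizing T to degree m - 1 by the leading
    coefficient gives V ([is_V_exists]). Uniqueness holds because a
    polynomial is determined by its values where A_m <> 0.

    Irreducibility. The polynomials having a pair of roots with product 1
    are those of the form (z^2 - s z + 1) G, which are parametrized by s and
    the coefficients of G, that is by an affine space; so a polynomial in
    A_0, ..., A_m restricts to this family as an element of an integral
    domain. V restricts to 0 ([pair_form_recip_tuple]). Hence if V = Q S,
    one of the factors, say Q, restricts to 0. Take B with the m - 1 roots b
    = 2, 3, ..., m. On the affine line x |-> (z - x) B the factor Q vanishes
    at the m - 1 points x = 1/b, and not at x = 0, where V does not vanish;
    therefore deg Q >= m - 1 = deg V and S is constant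
    ([pair_form_irreducible]). The surface is the same polynomial up to a
    rescaling of the variables, which is why the argument is carried out
    with weights on the variables.

    The boundary. If A has no zero in the closed disk then all its roots r
    satisfy |r| > 1, and A(z) = A(0) prod (1 - z/r) gives A(0) (1 - |z|)^m
    <= |A(z)| <= A(0) (1 + |z|)^m for |z| <= 1 ([norm_horner_bounds]). These
    bounds survive in the closure. So in the closure either A(0) <= 0,
    whence A(1) = 0 ([closure_Ploc_le0]), or A(0) > 0 and A has no zero in
    the open disk ([closure_Ploc_disk]). In the second case, a boundary
    point has a zero zeta on the unit circle, since the absence of zeros in
    the closed disk is an open condition ([interior_Ploc]). As A is real,
    either zeta is 1 or -1, or zeta and its conjugate are two distinct roots
    with product 1 ([conj_root_recip]), and then V vanishes
    ([zero_surface_recip]). *)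

(** * Evaluation of polynomials in several variables *)

(** Uniqueness of base-N digits, which makes the Kronecker substitution of x ^
    (N ^ i) for X_i injective on monomials whose exponents are below N. *)
Lemma digits_inj (N n : nat) (f g : 'I_n -> nat) :
  (forall i, f i < N)%N -> (forall i, g i < N)%N ->
  (\sum_(i < n) f i * N ^ i = \sum_(i < n) g i * N ^ i)%N -> f =1 g.
Proof.
elim: n f g => [|n IHn] f g ltf ltg; first by move=> _ [].
have E (h : 'I_n.+1 -> nat) : (\sum_(i < n.+1) h i * N ^ i
    = (\sum_(i < n) h (lift ord0 i) * N ^ i) * N + h ord0)%N.
  rewrite big_ord_recl muln1 addnC big_distrl /=; congr (_ + _)%N.
  by apply: eq_bigr => i _; rewrite /bump /= add1n expnS mulnA mulnAC.
rewrite !E => eqs.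
have N_gt0 : (0 < N)%N by apply: leq_ltn_trans (ltf ord0).
have eq0 : f ord0 = g ord0.
  by move/(congr1 (modn^~ N)): eqs; rewrite !modnMDl !modn_small.
have eqS : (fun i => f (lift ord0 i)) =1 (fun i => g (lift ord0 i)).
  apply: IHn => [i|i|]; [exact: ltf|exact: ltg|].
  by move/(congr1 (divn^~ N)): eqs;
    rewrite !divnMDl // !divn_small ?ltf ?ltg ?addn0.
by move=> i; case: (unliftP ord0 i) => [j|] ->; [exact: eqS|].
Qed.

Lemma poly_horner_eq0 (F : numDomainType) (q : {poly F}) :
  (forall x, q.[x] = 0) -> q = 0.
Proof.
move=> q0; apply/eqP; apply: contraT => nzq.
pose s : seq F := [seq i%:R | i <- iota 0 (size q)].
have us : uniq s.
  by rewrite map_inj_uniq ?iota_uniq // => i j /eqP; rewrite eqr_nat => /eqP.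
have rs : all (root q) s by apply/allP => x _; rewrite /root q0.
by have := max_poly_roots nzq rs us; rewrite size_map size_iota ltnn.
Qed.

(** The Kronecker substitution reduces the claim to one variable, where a
    nonzero polynomial has finitely many roots. *)
Lemma meval_eq0_mpoly (F : numDomainType) n (p : {mpoly F[n]}) :
  (forall v, p.@[v] = 0) -> p = 0.
Proof.
move=> p0; set N := msize p.
pose e (m : 'X_{1..n}) := (\sum_(i < n) m i * N ^ i)%N.
have ltN m : m \in msupp p -> forall i, (m i < N)%N.
  move=> /msize_mdeg_lt lt_mN i; apply: leq_ltn_trans lt_mN.
  by rewrite mdegE (bigD1 i) //= leq_addr.
have e_inj : {in msupp p &, injective e}.
  move=> m m' /ltN ltm /ltN ltm' eqe; apply/mnmP.
  exact: (@digits_inj N).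
pose q : {poly F} := \sum_(m <- msupp p) p@_m *: 'X^(e m).
have q0 : q = 0.
  apply: poly_horner_eq0 => x; rewrite -(p0 (fun i => x ^+ (N ^ i))) mevalE.
  rewrite horner_sum; apply: eq_bigr => m _.
  rewrite hornerZ hornerXn expr_sum; congr (_ * _); apply: eq_bigr => i _.
  by rewrite mulnC exprM.
apply/mpolyP => m; rewrite mcoeff0.
have [mp|/memN_msupp_eq0 //] := boolP (m \in msupp p).
have := coef0 F (e m); rewrite -{1}q0 /q (bigD1_seq m) ?msupp_uniq //=.
rewrite coefD coefZ coefXn eqxx mulr1 coef_sum big_seq_cond big1 ?addr0 //.
move=> m' /andP[m'p ne_m]; rewrite coefZ coefXn.
case: eqP => [eqe|_]; last by rewrite mulr0.
by rewrite (e_inj m m') ?eqxx // in ne_m.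
Qed.

Lemma meval_eq0_mpoly_off (F : numDomainType) n (i : 'I_n) (p : {mpoly F[n]}) :
  (forall v, v i != 0 -> p.@[v] = 0) -> p = 0.
Proof.
move=> p0; have /eqP : 'X_i * p = 0.
  apply: meval_eq0_mpoly => v; rewrite mevalM mevalXU.
  by have [->|/p0 ->] := eqVneq (v i) 0; rewrite ?mul0r ?mulr0.
by rewrite mulf_eq0 => /orP[/eqP/(congr1 (meval (fun=> 1)))|/eqP //];
  rewrite mevalXU meval0 => /eqP; rewrite oner_eq0.
Qed.

Lemma coefM_top (F : nzRingType) (p q : {poly F}) a b :
  (size p <= a.+1)%N -> (size q <= b.+1)%N ->
  (size (p * q)%R <= (a + b).+1)%N /\ (p * q)`_(a + b) = p`_a * q`_b.
Proof.
move=> sp sq; split.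
  by apply: leq_trans (size_polyMleq p q) _; lia.
have lta : (a < (a + b).+1)%N by rewrite ltnS leq_addr.
rewrite coefM (bigD1 (Ordinal lta)) //= addKn big1 ?addr0 // => i.
rewrite -val_eqE /= neq_ltn => /orP[lt_ia|lt_ai].
  by rewrite [q`__]nth_default ?mulr0 //; apply: leq_trans sq _; lia.
by rewrite nth_default ?mul0r //; apply: leq_trans sp _.
Qed.

Lemma coef_prod_top (F : comNzRingType) (I : Type) (r : seq I)
    (q : I -> {poly F}) (d : I -> nat) :
  (forall i, size (q i) <= (d i).+1)%N ->
  let p := \prod_(i <- r) q i in let e := (\sum_(i <- r) d i)%N in
  (size p <= e.+1)%N /\ p`_e = \prod_(i <- r) (q i)`_(d i).
Proof.
move=> sq /=; elim: r => [|i r [IHs IHc]].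
  by rewrite !big_nil size_poly1 coef1.
by have [s c] := coefM_top (sq i) IHs; rewrite !big_cons c IHc.
Qed.

Lemma coef_exp_top (F : comNzRingType) (q : {poly F}) (k : nat) :
  (size q <= 2)%N -> (size (q ^+ k)%R <= k.+1)%N /\ (q ^+ k)`_k = q`_1 ^+ k.
Proof.
move=> sq; elim: k => [|k [IHs IHc]]; first by rewrite !expr0 size_poly1 coef1.
have := @coefM_top _ q (q ^+ k) 1 k sq IHs; rewrite -exprS add1n => -[s c].
by rewrite s c IHc exprS.
Qed.

Section AffineLine.
Variables (F : comNzRingType) (n : nat) (l : 'I_n -> {poly F}).
Hypothesis sl : forall i, (size (l i) <= 2)%N.

(** Restriction to an affine line: the degree does not increase, and the
    coefficient of the expected top degree is the homogeneous part of that
    degree, evaluated at the direction of the line. *)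
Lemma mmap_line_top (p : {mpoly F[n]}) d : (msize p <= d.+1)%N ->
  (size (mmap polyC l p) <= d.+1)%N /\
  (mmap polyC l p)`_d = (pihomog mdeg d p).@[fun i => (l i)`_1].
Proof.
move=> sp.
have H m : (size (mmap1 l m) <= (mdeg m).+1)%N /\
    (mmap1 l m)`_(mdeg m) = \prod_(i < n) (l i)`_1 ^+ m i.
  have := @coef_prod_top F _ (index_enum 'I_n) (fun i => l i ^+ m i) m.
  rewrite -mdegE => /(_ (fun i => (coef_exp_top (m i) (sl i)).1)) [s c].
  split=> //; rewrite c; apply: eq_bigr => i _.
  exact: (coef_exp_top (m i) (sl i)).2.
have Hs m : m \in msupp p -> (size ((p@_m)%:P * mmap1 l m)%R <= d.+1)%N.
  move=> /msize_mdeg_lt lt_m; rewrite mul_polyC.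
  apply: leq_trans (size_scale_leq _ _) _; apply: leq_trans (H m).1 _.
  exact: leq_trans lt_m sp.
split.
  rewrite /mmap big_seq; apply: (leq_trans (size_sum _ _ _)).
  by apply/bigmax_leqP_seq => m _ mp; apply: Hs.
rewrite /mmap pihomogE coef_sum raddf_sum /= [RHS]big_mkcond /=.
rewrite big_seq [RHS]big_seq; apply: eq_bigr => m mp.
rewrite coefCM mevalZ mevalX; case: eqP => [<-|/eqP ne_d].
  by rewrite (H m).2.
rewrite nth_default ?mulr0 //; apply: leq_trans (H m).1 _.
have := leq_trans (msize_mdeg_lt mp) sp.
by rewrite ltnS leq_eqVlt (negPf ne_d).
Qed.

Lemma horner_mmap_line (p : {mpoly F[n]}) x :
  (mmap polyC l p).[x] = p.@[fun i => (l i).[x]].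
Proof.
rewrite /mmap mevalE horner_sum; apply: eq_bigr => m _.
rewrite hornerCM /mmap1 horner_prod; congr (_ * _).
by apply: eq_bigr => i _; rewrite horner_exp.
Qed.
End AffineLine.

(** * The product over pairs of roots and the polynomial V *)

(** Homogenization by a new last variable. The value is stated through a
    change of scalars because V has real coefficients and is evaluated at
    complex points. *)
Lemma homogenize (F : comNzRingType) n d (p : {mpoly F[n]}) :
  (msize p <= d.+1)%N ->
  exists2 q : {mpoly F[n.+1]}, q \is d.-homog &
    forall (K : fieldType) (f : {rmorphism F -> K}) (A : 'I_n.+1 -> K),
      A ord_max != 0 ->
      (map_mpoly f q).@[A] = A ord_max ^+ d *
        (map_mpoly f p).@[fun i => A (widen_ord (leqnSn n) i) / A ord_max].
Proof.
move=> sp; pose w := widen_ord (leqnSn n).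
pose M (m : 'X_{1..n}) :=
  (\sum_(i < n) U_(w i) *+ m i + U_(ord_max) *+ (d - mdeg m))%MM.
exists (\sum_(m <- msupp p) p@_m *: 'X_[M m]).
  rewrite big_seq; apply: rpred_sum => m mp; apply: rpredZ.
  rewrite dhomogX /= mdegD mdeg_sum mdegMn mdeg1 mul1n.
  rewrite (eq_bigr (fun i => m i)) => [|i _];
    last by rewrite mdegMn mdeg1 mul1n.
  by rewrite -mdegE subnKC // -ltnS (leq_trans (msize_mdeg_lt mp)).
move=> K f A nzA; rewrite [in RHS](mpolyE p).
rewrite 2!(raddf_sum (map_mpoly f)) 2!(raddf_sum (meval _)) mulr_sumr.
rewrite big_seq [RHS]big_seq; apply: eq_bigr => m mp.
rewrite /= !map_mpolyZ !map_mpolyX !mevalZ mulrCA; congr (_ * _).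
rewrite mpolyXD -mpolyXn mevalM rmorphXn /= mevalXU -mprodXnE rmorph_prod /=.
under eq_bigr do rewrite rmorphXn /= mevalXU.
rewrite mevalX; under [in RHS]eq_bigr do rewrite expr_div_n.
rewrite prodf_div -expr_sum -mdegE [RHS]mulrCA; congr (_ * _).
have le_md : (mdeg m <= d)%N by rewrite -ltnS (leq_trans (msize_mdeg_lt mp)).
by rewrite -{2}(subnK le_md) exprD mulfK // expf_neq0.
Qed.

(** The permutation s may reverse the order of a pair i < j; the change of
    indices sends the pair to (s i, s j) sorted again, and the symmetry of g
    absorbs the swap. *)
Lemma prod_pairs_perm (K : comNzRingType) n (g : 'I_n -> 'I_n -> K) (s : 'S_n) :
  (forall i j, g i j = g j i) ->
  \prod_(i < n) \prod_(j < n | (i < j)%N) g (s i) (s j) =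
  \prod_(i < n) \prod_(j < n | (i < j)%N) g i j.
Proof.
move=> gC; rewrite !pair_big_dep /=.
pose h (u : 'S_n) (x : 'I_n * 'I_n) :=
  if (u x.1 < u x.2)%N then (u x.1, u x.2) else (u x.2, u x.1).
rewrite [RHS](reindex_onto (h s) (h s^-1%g)) => [|[i j] /= lt_ij]; last first.
  rewrite [h s^-1%g _]/h /=; case: ltnP => _; rewrite /h /= !permKV ?lt_ij //.
  by rewrite ltnNge ltnW.
apply: eq_big => [[i j]|[i j] lt_ij] /=; last by rewrite /h /=; case: ifP.
have swapE : ((j, i) == (i, j)) = (i == j).
  by rewrite xpair_eqE eq_sym andbb.
rewrite /h /=; case: (ltngtP (s i) (s j)) => [lt_s|lt_s|/val_inj/perm_inj ->].
- rewrite lt_s /= !permK; case: (ltngtP i j) => [|_|/val_inj e] /=.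
  + by rewrite eqxx.
  + by rewrite swapE; apply/esym/eqP => e; rewrite e ltnn in lt_s.
  + by rewrite e ltnn in lt_s.
- rewrite lt_s /= !permK; case: (ltngtP i j) => [|lt_ji|/val_inj e] /=.
  + by rewrite eqxx.
  + by rewrite swapE; apply/esym/eqP => e; rewrite e ltnn in lt_s.
  + by rewrite e ltnn in lt_s.
- by rewrite !ltnn.
Qed.

Definition pair_prod (K : comNzRingType) m (a : 'I_m -> K) : K :=
  \prod_(i < m) \prod_(j < m | (i < j)%N) (a i * a j - 1).

Lemma rmorph_pair_prod (F K : comNzRingType) (f : {rmorphism F -> K}) m
    (a : 'I_m -> F) : f (pair_prod a) = pair_prod (f \o a).
Proof.
rewrite rmorph_prod; apply: eq_bigr => i _; rewrite rmorph_prod.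
by apply: eq_bigr => j _; rewrite rmorphB rmorphM rmorph1.
Qed.

Arguments rmorph_pair_prod {F K} f {m} a.

Lemma pair_prod_sym (F : comNzRingType) m :
  pair_prod (fun i : 'I_m => 'X_i : {mpoly F[m]}) \is symmetric.
Proof.
apply/issymP => s; rewrite (rmorph_pair_prod (msym s)).
under [LHS]eq_bigr => i _.
  under eq_bigr => j _ do rewrite /= /msym !mmapX !mmap1U.
  over.
by rewrite (prod_pairs_perm (g := fun i j => 'X_i * 'X_j - 1)) // => i j;
  rewrite mulrC.
Qed.

Lemma map_mesym (F K : nzRingType) (f : {rmorphism F -> K}) n k :
  map_mpoly f (mesym n F k) = mesym n K k.
Proof.
rewrite /mesym rmorph_sum; apply: eq_bigr => h _; rewrite rmorph_prod.
by apply: eq_bigr => i _; rewrite /= map_mpolyX.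
Qed.

Lemma meval_map_comp (F K : fieldType) (f : {rmorphism F -> K}) n k
    (lq : n.-tuple {mpoly F[k]}) (p : {mpoly F[n]}) (v : 'I_k -> K) :
  (map_mpoly f (p \mPo lq)).@[v] =
  (map_mpoly f p).@[fun i => (map_mpoly f (tnth lq i)).@[v]].
Proof.
rewrite map_mpoly_comp; last exact: fmorph_inj.
by rewrite comp_mpoly_meval; apply: meval_eq => i; rewrite tnth_map.
Qed.

(** The fundamental theorem on symmetric polynomials, with the elementary
    symmetric polynomials replaced by the coefficients: by Viete, the
    elementary symmetric polynomial of index i + 1 is (-1)^(i+1) times the
    coefficient of index m - 1 - i. *)
Lemma pair_prod_coefs (F : fieldType) m :
  exists T : {mpoly F[m]},
    forall (K : fieldType) (f : {rmorphism F -> K}) (a : 'I_m -> K),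
    (map_mpoly f T).@[fun k => (\prod_(i < m) ('X - (a i)%:P))`_k] =
    pair_prod a.
Proof.
have [t [tS _]] := sym_fundamental (pair_prod_sym F m).
exists (t \mPo [tuple (-1) ^+ i.+1 *: 'X_(rev_ord i) | i < m]) => K f a.
rewrite meval_map_comp.
have /(congr1 (fun p => (map_mpoly f p).@[a])) := tS.
rewrite meval_map_comp (rmorph_pair_prod (map_mpoly f)) rmorph_pair_prod.
have -> : pair_prod (meval a \o (map_mpoly f \o (fun i : 'I_m => 'X_i))) =
  pair_prod a.
  by apply: eq_bigr => i _; apply: eq_bigr => j _;
    rewrite /= !map_mpolyX !mevalXU.
move=> <-; apply: meval_eq => i; rewrite !tnth_mktuple.
rewrite map_mpolyZ map_mpolyX mevalZ mevalXU map_mesym.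
have := @mroots_coeff K m [tuple a i | i < m] (lift ord0 i).
rewrite big_tuple; under eq_bigr do rewrite tnth_mktuple.
rewrite /= /bump /= add1n => ->.
rewrite rmorphXn rmorphN1 mulrA -exprD addnn -signr_odd odd_double mul1r.
by apply: meval_eq => j; rewrite tnth_mktuple.
Qed.

Lemma closed_field_split (C : closedFieldType) n (B : {poly C}) :
  size B = n.+1 ->
  exists a : 'I_n -> C, B = lead_coef B *: \prod_(i < n) ('X - (a i)%:P).
Proof.
move=> sB; have [r Br] := closed_field_poly_normal B.
have nzB : lead_coef B != 0 by rewrite lead_coef_eq0 -size_poly_eq0 sB.
have sr : size r = n.
  by move: sB; rewrite {1}Br size_scale // size_prod_XsubC => -[].
exists (fun i => r`_i); rewrite {1}Br; congr (_ *: _).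
by rewrite (big_nth 0) big_mkord sr.
Qed.

Definition fcons (T : Type) n (x : T) (a : 'I_n -> T) (i : 'I_n.+1) : T :=
  if unlift ord0 i is Some j then a j else x.

Lemma fcons0 (T : Type) n (x : T) (a : 'I_n -> T) : fcons x a ord0 = x.
Proof. by rewrite /fcons unlift_none. Qed.

Lemma fconsS (T : Type) n (x : T) (a : 'I_n -> T) j :
  fcons x a (lift ord0 j) = a j.
Proof. by rewrite /fcons liftK. Qed.

Lemma pair_prod_cons (K : comNzRingType) n (x : K) (a : 'I_n -> K) :
  pair_prod (fcons x a) = (\prod_(j < n) (x * a j - 1)) * pair_prod a.
Proof.
rewrite /pair_prod big_ord_recl big_mkcond big_ord_recl /= mul1r.
congr (_ * _); first by apply: eq_bigr => j _; rewrite fcons0 fconsS.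
apply: eq_bigr => i _; rewrite big_mkcond big_ord_recl /= mul1r [RHS]big_mkcond.
by apply: eq_bigr => j _; rewrite !fconsS /bump /= !add1n ltnS.
Qed.

Lemma prod_XsubC_cons (K : comNzRingType) n (x : K) (a : 'I_n -> K) :
  \prod_(i < n.+1) ('X - (fcons x a i)%:P) =
  ('X - x%:P) * \prod_(i < n) ('X - (a i)%:P).
Proof.
by rewrite big_ord_recl fcons0; under eq_bigr do rewrite fconsS.
Qed.

(** The coefficient of index k of ('X - x) * B, as an affine function of x. *)
Definition coef_line (K : comNzRingType) (B : {poly K}) (k : nat) : {poly K} :=
  (('X * B)`_k)%:P - B`_k *: 'X.

Lemma size_coef_line (K : comNzRingType) (B : {poly K}) k :
  (size (coef_line B k) <= 2)%N.
Proof.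
apply: leq_trans (size_polyD _ _) _; rewrite geq_max size_polyN.
rewrite (leq_trans (size_polyC_leq1 _)) //.
by rewrite (leq_trans (size_scale_leq _ _)) // size_polyX.
Qed.

Lemma coef1_coef_line (K : comNzRingType) (B : {poly K}) k :
  (coef_line B k)`_1 = - B`_k.
Proof. by rewrite coefB coefC coefZ coefX /= mulr1 sub0r. Qed.

Lemma horner_coef_line (K : comNzRingType) (B : {poly K}) k x :
  (coef_line B k).[x] = (('X - x%:P) * B)`_k.
Proof. by rewrite mulrBl coefB coefCM !hornerE [x * _]mulrC. Qed.

Lemma mcoeff_pihomog (K : nzRingType) n d (p : {mpoly K[n]}) m :
  (pihomog mdeg d p)@_m = if mdeg m == d then p@_m else 0.
Proof.
rewrite pihomogE raddf_sum /=; case: eqP => [<-|ne_d]; last first.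
  rewrite big1 // => m' /eqP dm'; rewrite mcoeffZ mcoeffX.
  case: eqP => [e|]; last by rewrite mulr0.
  by case: ne_d; rewrite -e.
rewrite [in RHS](mpolyE p) raddf_sum /= big_mkcond; apply: eq_bigr => m' _.
rewrite mcoeffZ mcoeffX; case: (eqVneq m' m) => [->|_]; first by rewrite eqxx.
by rewrite mulr0; case: ifP.
Qed.

Lemma meval_homog_scale (K : comNzRingType) n d (p : {mpoly K[n]}) c v :
  p \is d.-homog -> p.@[fun i => c * v i] = c ^+ d * p.@[v].
Proof.
move=> /dhomogP hp; rewrite !mevalE mulr_sumr big_seq [RHS]big_seq.
apply: eq_bigr => m mp; rewrite mulrCA; congr (_ * _).
under eq_bigr do rewrite exprMn.
by rewrite big_split /= -expr_sum -mdegE hp.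
Qed.

(** If T had degree d > m, consider its restriction to the line of
    coefficients of (X - x) B with B monic of degree m: the product over pairs
    has degree at most m in x, so its coefficient of degree d vanishes. That
    coefficient is the part of degree d of T at the direction of the line,
    namely - B; by homogeneity this part vanishes at every w whose last entry
    is nonzero, so it is zero. *)
Lemma msize_pair_prod_coefs (C : numClosedFieldType) m (T : {mpoly C[m.+1]}) :
  (forall a : 'I_m.+1 -> C,
    T.@[fun k => (\prod_(i < m.+1) ('X - (a i)%:P))`_k] = pair_prod a) ->
  (msize T <= m.+1)%N.
Proof.
move=> Tpair; rewrite leqNgt; apply/negP => lt_mT.
pose d := (msize T).-1.
have lt_md : (m < d)%N by rewrite /d; lia.
have nzT : T != 0 by apply: contraTneq lt_mT => ->; rewrite msize0.
have dT : msize T = d.+1 by rewrite /d mpolySpred.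
suff P0 : pihomog mdeg d T = 0.
  have := mcoeff_pihomog d T (mlead T).
  rewrite P0 mcoeff0 -(eqn_add2r 1) !addn1 mlead_deg // dT eqxx => /esym/eqP.
  by rewrite mcoeff_eq0 mlead_supp.
apply: (@meval_eq0_mpoly_off _ _ ord_max) => w nzw.
(* The monic polynomial whose coefficients are proportional to w. *)
pose B : {poly C} := \poly_(k < m.+1) (w (inord k) / w ord_max).
have sB : size B = m.+1.
  by rewrite size_poly_eq //= -[m]/(val (@ord_max m)) inord_val divff ?oner_eq0.
have lB : lead_coef B = 1.
  by rewrite lead_coefE sB coef_poly ltnSn -[m]/(val (@ord_max m)) inord_val
    divff.
have [a] := closed_field_split sB; rewrite lB scale1r => Ba.
have [_] := mmap_line_top (fun k : 'I_m.+1 => size_coef_line B k) (eq_leq dT).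
set q := mmap _ _ _.
have -> : q = (\prod_(j < m) (a j *: 'X - 1)) * (pair_prod a)%:P.
  apply/eqP; rewrite -subr_eq0; apply/eqP/poly_horner_eq0 => x.
  rewrite hornerD hornerN horner_mmap_line.
  rewrite (meval_eq _ (fun k => horner_coef_line B k x)) Ba -prod_XsubC_cons.
  rewrite Tpair pair_prod_cons hornerM horner_prod hornerC.
  apply/eqP; rewrite subr_eq0; apply/eqP; congr (_ * _).
  by apply: eq_bigr => j _; rewrite !hornerE mulrC.
rewrite nth_default => [|]; last first.
  have sl (i : 'I_m) : (size (a i *: 'X - 1)%R <= 2)%N.
    apply: leq_trans (size_polyD _ _) _; rewrite geq_max size_polyN size_poly1.
    by rewrite (leq_trans (size_scale_leq _ _)) // size_polyX.
  have [+ _] := @coef_prod_top _ _ (index_enum 'I_m) _ (fun=> 1%N) sl.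
  rewrite sum1_card card_ord => s; rewrite mulrC mul_polyC.
  by apply: leq_trans (size_scale_leq _ _) _; apply: leq_trans s _.
rewrite (meval_eq _ (fun k => coef1_coef_line B k)).
have -> : (fun k : 'I_m.+1 => - B`_k) = (fun k => - (w ord_max)^-1 * w k).
  apply/funext => k; rewrite coef_poly ltn_ord inord_val mulNr; congr (- _).
  exact: mulrC.
rewrite (meval_homog_scale _ _ (pihomogP _ _ _)) => /esym/eqP.
by rewrite mulf_eq0 expf_eq0 oppr_eq0 invr_eq0 (negPf nzw) andbF => /eqP.
Qed.

Lemma map_mpoly_inj (F : fieldType) (K : nzRingType) (f : {rmorphism F -> K})
  n :
  injective (@map_mpoly n F K f).
Proof.
move=> p q e; apply/mpolyP => m; apply: (fmorph_inj f).
by rewrite -!mcoeff_map_mpoly e.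
Qed.

Lemma msize_map_mpoly (F : fieldType) (K : nzRingType) (f : {rmorphism F -> K})
  n (p : {mpoly F[n]}) : msize (map_mpoly f p) = msize p.
Proof.
by rewrite !msizeE (perm_big _ (msupp_map_mpoly p (@fmorph_inj _ _ f))).
Qed.

Lemma is_V_exists (R : realType) m :
  exists2 V : {mpoly R[m.+2]}, is_V (m := m.+1) V & V \is m.-homog.
Proof.
have [T HT] := pair_prod_coefs R m.+1.
have sT : (msize T <= m.+1)%N.
  rewrite -(msize_map_mpoly (real_complex R)).
  by apply: msize_pair_prod_coefs => a; apply: HT.
have [V hV VT] := homogenize sT; exists V => //; split; first by exists m.
move=> A alpha nzA eA; rewrite VT // -[\prod_(i < m.+1) _]/(pair_prod alpha).
rewrite -(HT _ (real_complex R)); congr (_ * _); apply: meval_eq => k.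
have := congr1 (fun p : {poly R[i]} => p`_k) eA.
rewrite coefZ coef_sum (bigD1 (widen_ord (leqnSn m.+1) k)) //= big1 => [|i
  ne_i].
  by rewrite coefZ coefXn eqxx mulr1 addr0 => ->; rewrite mulrC mulKf.
rewrite coefZ coefXn; case: eqP => [e|]; last by rewrite mulr0.
by rewrite -val_eqE /= e eqxx in ne_i.
Qed.

Lemma size_top_coef (K : nzRingType) m (A : 'I_m.+1 -> K) : A ord_max != 0 ->
  let P := \sum_(k < m.+1) A k *: 'X^k in
  size P = m.+1 /\ lead_coef P = A ord_max.
Proof.
move=> nzA; pose P := \poly_(k < m.+1) A (inord k).
have -> : \sum_(k < m.+1) A k *: 'X^k = P.
  by rewrite /P poly_def; apply: eq_bigr => k _; rewrite inord_val.
have Am : A (inord m) = A ord_max by rewrite -[m in inord m]/(val (@ord_max m))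
  inord_val.
have sP : size P = m.+1 by rewrite size_poly_eq //= Am.
by rewrite /= lead_coefE sP coef_poly ltnSn Am.
Qed.

(** Over an algebraically closed field every A with A_m <> 0 has a family of
    roots, so both polynomials agree off the hyperplane A_m = 0. *)
Lemma is_V_unique (R : realType) m (V W : {mpoly R[m.+1]}) :
  is_V V -> is_V W -> V = W.
Proof.
move=> [_ HV] [_ HW]; apply: (map_mpoly_inj (f := real_complex R)).
apply/eqP; rewrite -subr_eq0; apply/eqP.
apply: (@meval_eq0_mpoly_off _ _ ord_max) => A nzA.
have [sP lP] := size_top_coef nzA.
have [a eA] := closed_field_split sP; rewrite lP in eA.
by rewrite mevalB (HV _ _ nzA eA) (HW _ _ nzA eA) subrr.
Qed.

(** * Polynomials with two reciprocal roots and irreducibility *)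

Lemma recip_quadratic (K : nzRingType) (s : K) :
  size ('X^2 - s *: 'X + 1) = 3 /\ lead_coef ('X^2 - s *: 'X + 1) = 1.
Proof.
have := @size_top_coef K 2 (fun i => [:: 1; - s; 1]`_i) (oner_neq0 _).
rewrite !big_ord_recl big_ord0 /= addr0 scale1r expr0 expr1 scaleNr scale1r.
by rewrite [1 + _]addrC [- _ + _]addrC.
Qed.

Section PairForm.
Variables (C : numClosedFieldType) (k : nat) (c : 'I_k.+3 -> C).

(** The defining property of V, up to the weights c: W is V after the change
    of variables A_i = v_i / c_i. The weights 1 / (i + 1) give the surface. *)
Definition pair_form (W : {mpoly C[k.+3]}) : Prop :=
  forall (A : 'I_k.+3 -> C) (a : 'I_k.+2 -> C), A ord_max != 0 ->
    \sum_(i < k.+3) A i *: 'X^i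
      = A ord_max *: \prod_(i < k.+2) ('X - (a i)%:P) ->
    W.@[fun i => c i * A i] = A ord_max ^+ k.+1 * pair_prod a.

Lemma pair_form_poly (W : {mpoly C[k.+3]}) (y : C) (a : 'I_k.+2 -> C) :
  pair_form W -> y != 0 ->
  W.@[fun i => c i * (y *: \prod_(i < k.+2) ('X - (a i)%:P))`_i] =
  y ^+ k.+1 * pair_prod a.
Proof.
move=> HW nzy; set P := y *: _.
have sP : size P = k.+3.
  by rewrite size_scale // size_prod_XsubC /index_enum -enumT size_enum_ord.
have Pm : P`_(@ord_max k.+2) = y.
  transitivity (lead_coef P); first by rewrite lead_coefE sP.
  by rewrite lead_coefZ (monicP _) ?mulr1 // monic_prod_XsubC.
rewrite (HW (fun i : 'I_k.+3 => P`_i) a) Pm //.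
by rewrite -[RHS](coefK) sP poly_def.
Qed.

(** X^2 - s X + 1 is the general monic quadratic with reciprocal roots x and
    1/x, where s = x + 1/x. *)
Definition recip_mult (K : comNzRingType) (s : K) (G : {poly K}) : {poly K} :=
  ('X^2 - s *: 'X + 1) * G.

Lemma map_recip_mult (K L : comNzRingType) (f : {rmorphism K -> L}) s G :
  map_poly f (recip_mult s G) = recip_mult (f s) (map_poly f G).
Proof.
rewrite /recip_mult rmorphM rmorphD rmorphB rmorph1 /=.
by rewrite map_polyXn map_polyZ map_polyX.
Qed.

(** The weighted coefficients of the generic multiple of a quadratic with
    reciprocal roots: the last variable is s, the others are the coefficients
    of the cofactor. *)
Definition recip_tuple : k.+3.-tuple {mpoly C[k.+2]} :=
  [tuple c i *: (recip_mult 'X_ord_max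
     (\sum_(j < k.+1) 'X_(widen_ord (leqnSn k.+1) j) *: 'X^j))`_i | i < k.+3].

Lemma meval_recip_tuple (p : {mpoly C[k.+3]}) v :
  (p \mPo recip_tuple).@[v] =
  p.@[fun i => c i * (recip_mult (v ord_max)
     (\sum_(j < k.+1) v (widen_ord (leqnSn k.+1) j) *: 'X^j))`_i].
Proof.
rewrite comp_mpoly_meval; apply: meval_eq => i.
rewrite tnth_mktuple mevalZ -coef_map map_recip_mult /= mevalXU rmorph_sum.
congr (c i * (recip_mult _ _)`_i); apply: eq_bigr => j _.
by rewrite /= map_polyZ /= mevalXU map_polyXn.
Qed.

(** When the cofactor G has full degree, its roots and the two reciprocal ones
    form a family whose product over pairs has a zero factor; full degree is
    generic. *)
Lemma pair_form_recip_tuple W : pair_form W -> W \mPo recip_tuple = 0.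
Proof.
move=> HW; apply: (@meval_eq0_mpoly_off _ _ (widen_ord (leqnSn k.+1) ord_max)).
move=> v nzv; rewrite meval_recip_tuple.
have [sG lG] := @size_top_coef _ _
  (fun j : 'I_k.+1 => v (widen_ord (leqnSn k.+1) j)) nzv.
have [b ->] := closed_field_split sG; rewrite {}lG; set y := v _ in nzv *.
set s := v _.
have sQ := recip_quadratic s.
have [a] := closed_field_split sQ.1;
  rewrite sQ.2 scale1r !big_ord_recl big_ord0 mulr1.
set a0 := a _; set a1 := a _ => Qa.
have a01 : a0 * a1 = 1.
  have := congr1 (fun p : {poly C} => p.[0]) Qa.
  by rewrite !hornerE expr0n subrr add0r mulrNN => <-.
rewrite /recip_mult Qa -scalerAr -mulrA -!prod_XsubC_cons pair_form_poly //.
rewrite pair_prod_cons big_ord_recl fcons0 a01 subrr !mul0r mulr0 //.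
Qed.

(** Specialization of the parameters; here the degree of G may drop, which is
    what allows the leading coefficient A_m to vanish. *)
Lemma recip_tuple_eq0 (p : {mpoly C[k.+3]}) (s : C) (G : {poly C}) :
  p \mPo recip_tuple = 0 -> (size G <= k.+1)%N ->
  p.@[fun i => c i * (recip_mult s G)`_i] = 0.
Proof.
move=> p0 sG; pose v (i : 'I_k.+2) :=
  if unlift ord_max i is Some j then G`_j else s.
have vs : v ord_max = s by rewrite /v unlift_none.
have vG : \sum_(j < k.+1) v (widen_ord (leqnSn k.+1) j) *: 'X^j = G.
  rewrite (eq_bigr (fun j : 'I_k.+1 => G`_j *: 'X^j)) => [|j _]; last first.
    have -> : widen_ord (leqnSn k.+1) j = lift ord_max j.
      by apply: val_inj; rewrite /= /bump leqNgt ltn_ord.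
    by rewrite /v liftK.
  rewrite -(poly_def _ (fun i => G`_i)); apply/polyP => j; rewrite coef_poly.
  by case: ltnP => // le_j; rewrite nth_default // (leq_trans sG).
by have := meval_recip_tuple p v; rewrite p0 meval0 vs vG.
Qed.

Let B : {poly C} := \prod_(j < k.+1) ('X - (j.+2%:R)%:P).

(** On the line x |-> (X - x) B the polynomial Q vanishes whenever x is the
    inverse of a root of B, since x and that root are then reciprocal roots.
    This makes k + 1 zeros of a nonzero polynomial in x whose degree is at
    most that of Q. *)
Lemma msize_recip_tuple_eq0 (Q : {mpoly C[k.+3]}) :
  Q \mPo recip_tuple = 0 -> Q.@[fun i => c i * ('X * B)`_i] != 0 ->
  (k.+2 <= msize Q)%N.
Proof.
move=> Q0 QB; have nzQ : Q != 0 by apply: contra_neq QB => ->; rewrite meval0.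
pose l (i : 'I_k.+3) := c i *: coef_line B i.
have sl i : (size (l i) <= 2)%N.
  by apply: leq_trans (size_scale_leq _ _) _; apply: size_coef_line.
have [] := @mmap_line_top _ _ l sl Q (msize Q).-1 (leqSpred _).
have Ql x : (mmap polyC l Q).[x] = Q.@[fun i => c i * (('X - x%:P) * B)`_i].
  by rewrite horner_mmap_line; apply: meval_eq => i;
    rewrite hornerZ horner_coef_line.
rewrite -mpolySpred // => sq _; apply: leq_trans sq.
have nzq : mmap polyC l Q != 0.
  by apply: contra_neq QB => q0; have := Ql 0; rewrite q0 horner0 subr0 => <-.
pose r : seq C := [seq (j.+2%:R)^-1 | j <- iota 0 k.+1].
have ur : uniq r.
  rewrite map_inj_uniq ?iota_uniq // => i j /invr_inj/eqP.
  by rewrite eqr_nat !eqSS => /eqP.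
have rr : all (root (mmap polyC l Q)) r.
  apply/allP => _ /mapP[j + ->]; rewrite mem_iota add0n => /andP[_ lt_j].
  pose b : C := j.+2%:R; have nzb : b != 0 by rewrite pnatr_eq0.
  pose B' : {poly C} := \prod_(i < k.+1 | i != Ordinal lt_j) ('X -
    (i.+2%:R)%:P).
  have BE : B = ('X - b%:P) * B' by rewrite /B (bigD1 (Ordinal lt_j)).
  have sB : size B = k.+2.
    by rewrite /B size_prod_XsubC /index_enum -enumT size_enum_ord.
  have nzB' : B' != 0.
    by apply: contra_eq_neq sB => B'0; rewrite BE B'0 mulr0 size_poly0.
  have sB' : (size B' <= k.+1)%N.
    by have := sB; rewrite BE size_mul ?polyXsubC_eq0 // size_XsubC /= => -[];
      rewrite add0n => ->.
  have lB : ('X - b^-1%:P) * B = recip_mult (b + b^-1) B'.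
    rewrite BE mulrA /recip_mult; congr (_ * B');
      rewrite -mul_polyC [(b + _)%:P]polyCD.
    have : (b^-1)%:P * b%:P = 1 :> {poly C} by rewrite -polyCM mulVf.
    by move: (b^-1)%:P b%:P 'X => u w X uw; rewrite -uw; ring.
  by rewrite /root Ql lB recip_tuple_eq0.
by have := max_poly_roots nzq rr ur; rewrite size_map size_iota.
Qed.

(** In W = Q S one factor vanishes identically on the multiples of quadratics
    with reciprocal roots, as these form an affine space; that factor already
    has the full degree of W. *)
Lemma pair_form_irreducible (W : {mpoly C[k.+3]}) :
  pair_form W -> (msize W <= k.+2)%N ->
  irreducible_elt W /\ msize W = k.+2.
Proof.
move=> HW sW; have W0 := pair_form_recip_tuple HW.
have WB : W.@[fun i => c i * ('X * B)`_i] != 0.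
  (* With roots 0, 2, 3, ... no two roots have product 1. *)
  have := pair_form_poly (fcons 0 (fun j : 'I_k.+1 => j.+2%:R)) HW (oner_neq0
    _).
  rewrite prod_XsubC_cons subr0 scale1r => ->;
    rewrite expr1n mul1r pair_prod_cons.
  rewrite mulf_neq0 //; apply/prodf_neq0 => i _.
    by rewrite mul0r sub0r oppr_eq0 oner_eq0.
  by apply/prodf_neq0 => j _; rewrite subr_eq0 -natrM pnatr_eq1.
have nzW : W != 0 by apply: contra_neq WB => ->; rewrite meval0.
have sWE : msize W = k.+2.
  by apply/eqP; rewrite eqn_leq sW msize_recip_tuple_eq0.
have unit_of (Q S : {mpoly C[k.+3]}) : W = Q * S -> Q \mPo recip_tuple = 0 ->
    S \is a GRing.unit.
  move=> WE Q0; have /andP[nzQ nzS] : (Q != 0) && (S != 0).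
    by rewrite -negb_or -mulf_eq0 -WE.
  have sQ : (k.+2 <= msize Q)%N.
    apply: msize_recip_tuple_eq0 => //; apply: contra_neq WB.
    by rewrite WE mevalM => ->; rewrite mul0r.
  have /msize_poly1P[y nzy ->] : msize S == 1%N.
    have s0 := mpolySpred mdeg nzS.
    have := sWE; rewrite WE msizeM //; move: sQ s0.
    by move: (msize Q) (msize S) => a b; lia.
  by apply/unitrP; exists (y^-1)%:MP; rewrite -!mpolyCM mulVf ?mulfV.
split=> //; split=> //.
  apply/negP => /andP[/eqP WC _]; have := sWE; rewrite WC msizeC.
  by case: eqP.
move=> Q S WE.
have /eqP : (Q \mPo recip_tuple) * (S \mPo recip_tuple) = 0.
  have := rmorphM (comp_mpoly recip_tuple) Q S.
  by rewrite -WE /= W0 => <-.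
rewrite mulf_eq0 => /orP[] /eqP h0; [right|left].
  exact: unit_of WE h0.
by apply: unit_of h0; rewrite mulrC.
Qed.
End PairForm.

(** * Linear forms and the surface *)

Lemma msize2_irreducible (F : fieldType) n (p : {mpoly F[n]}) :
  msize p = 2 -> irreducible_elt p.
Proof.
move=> sp; have nzp : p != 0 by apply: contra_eq_neq sp => ->; rewrite msize0.
have unitC (q : {mpoly F[n]}) : msize q = 1%N -> q \is a GRing.unit.
  move=> /eqP/msize_poly1P[y nzy ->]; apply/unitrP.
  by exists (y^-1)%:MP; rewrite -!mpolyCM mulVf ?mulfV.
split=> //.
  by apply/negP => /andP[/eqP pC _]; move: sp; rewrite pC msizeC; case: eqP.
move=> q r pE; have /andP[nzq nzr] : (q != 0) && (r != 0).
  by rewrite -negb_or -mulf_eq0 -pE.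
have sq := mpolySpred mdeg nzq; have sr := mpolySpred mdeg nzr.
have : msize q = 1%N \/ msize r = 1%N.
  by move: sp; rewrite pE msizeM //; move: sq sr; move: (msize q) (msize r);
    lia.
by move=> [/unitC|/unitC]; [left|right].
Qed.

Lemma msize_linear_form (F : nzRingType) n (w : 'I_n -> F) (i : 'I_n) :
  w i != 0 -> msize (\sum_(i < n) w i *: 'X_i) = 2.
Proof.
move=> nzw; apply/eqP; rewrite eqn_leq; apply/andP; split.
  apply: leq_trans (msize_sum _ _ _) _; apply/bigmax_leqP => j _.
  by apply: leq_trans (msizeZ_le _ _) _; rewrite msizeX mdeg1.
apply: (@leq_trans (mdeg U_(i)).+1); first by rewrite mdeg1.
apply: msize_mdeg_lt.
rewrite mcoeff_msupp raddf_sum /= (bigD1 i) //= big1 => [|j ne_j].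
  by rewrite mcoeffZ mcoeffX eqxx mulr1 addr0.
by rewrite mcoeffZ mcoeffX eq_mnm1 (negPf ne_j) mulr0.
Qed.

Lemma linear_form_irreducible (R : realType) n (w : 'I_n -> R) (i : 'I_n) :
  w i != 0 -> irreducible_of_order 1 (\sum_(i < n) w i *: 'X_i).
Proof.
move=> nzw; have sw := msize_linear_form nzw; split=> //.
by apply: msize2_irreducible; rewrite msize_map_mpoly.
Qed.

Lemma dhomog_msize_leq (F : nzRingType) n d (p : {mpoly F[n]}) :
  p \is d.-homog -> (msize p <= d.+1)%N.
Proof.
move=> /dhomogP hp; rewrite msizeE; apply/bigmax_leqP_seq => m mp _.
by rewrite ltnS (hp m mp).
Qed.

Lemma dhomog_comp (F : comNzRingType) n k d (p : {mpoly F[n]})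
    (lq : n.-tuple {mpoly F[k]}) :
  p \is d.-homog -> (forall i, tnth lq i \is 1.-homog) ->
  p \mPo lq \is d.-homog.
Proof.
move=> /dhomogP hp hq; rewrite comp_mpolyE big_seq; apply: rpred_sum => m mp.
apply: rpredZ; rewrite -(hp m mp) /= mdegE.
apply: (big_ind2 (fun (q : {mpoly F[k]}) e => q \is e.-homog)).
- exact: dhomog1.
- by move=> q e r f hq' hr; apply: dhomogM.
- by move=> i _; have := dhomogMn (m i) (hq i); rewrite mul1n.
Qed.

Lemma meval_map_mpoly (F K : comNzRingType) (f : {rmorphism F -> K}) n
    (p : {mpoly F[n]}) v : (map_mpoly f p).@[f \o v] = f p.@[v].
Proof.
rewrite [in LHS](mpolyE p) (raddf_sum (map_mpoly f)) (raddf_sum (meval _))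
  mevalE.
rewrite rmorph_sum; apply: eq_bigr => m _.
rewrite /= map_mpolyZ map_mpolyX mevalZ mevalX rmorphM rmorph_prod;
  congr (_ * _).
by apply: eq_bigr => i _; rewrite rmorphXn.
Qed.

Lemma coef_deriv_poly_of (R : realType) n (a : 'rV[R]_n) (i : 'I_n) :
  (poly_of a)^`()`_i = a 0 i * i.+1%:R.
Proof.
rewrite coef_deriv /poly_of coef_sum (bigD1 i) //= big1 => [|j ne_j].
  by rewrite coefZ coefXn eqxx mulr1 addr0 mulr_natr.
by rewrite coefZ coefXn eqSS eq_sym -(inj_eq val_inj) in ne_j *;
  rewrite (negPf ne_j) mulr0.
Qed.

Section Surface.
Variables (R : realType) (k : nat) (n_ge3 : (3 <= k.+3)%N).
Variables (V : {mpoly R[k.+3]}).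
Hypotheses (HV : is_V (m := k.+2) V) (hV : V \is k.+1.-homog).

Let c (i : 'I_k.+3) : R[i] := i.+1%:R^-1.

Lemma surface_pair_form :
  pair_form c (map_mpoly (real_complex R) (surfaceA n_ge3 V)).
Proof.
move=> A a nzA eA; rewrite meval_map_comp -(HV.2 A a nzA eA).
apply: meval_eq => i; rewrite tnth_mktuple map_mpolyZ map_mpolyX mevalZ mevalXU.
have -> : cast_ord (ltn_predK n_ge3) i = i by apply: val_inj.
by rewrite rmorph_nat /c mulVKf // pnatr_eq0.
Qed.

Lemma surface_irreducible : irreducible_of_order (k.+3 - 2) (surfaceA n_ge3 V).
Proof.
rewrite /irreducible_of_order -(msize_map_mpoly (real_complex R)) subSS subSS
  subn0.
apply: (@pair_form_irreducible R[i] k c); first exact: surface_pair_form.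
rewrite msize_map_mpoly; apply: dhomog_msize_leq; apply: dhomog_comp => // i.
by rewrite tnth_mktuple; apply: rpredZ; rewrite dhomogX /= mdeg1.
Qed.

(** The weights undo the factors k + 1 of the derivative. The degree of G may
    be less than k, which covers the points with a_n = 0. *)
Lemma zero_surface_recip (a : 'rV[R]_k.+3) (s : R[i]) (G : {poly R[i]}) :
  map_poly (real_complex R) (poly_of a)^`() = recip_mult s G ->
  (size G <= k.+1)%N -> zero_set (surfaceA n_ge3 V) a.
Proof.
move=> aE sG; apply: (@complexI R); rewrite -meval_map_mpoly rmorph0.
have := recip_tuple_eq0 s (pair_form_recip_tuple surface_pair_form) sG.
rewrite -aE => <-; apply: meval_eq => i; rewrite coef_map coef_deriv_poly_of /=.
by rewrite rmorphM rmorph_nat /c mulrC mulfK // pnatr_eq0.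
Qed.
End Surface.

(** * Polynomials without zeros in the closed disk *)

Section ZeroFreeBounds.
Variables (C : numClosedFieldType) (A : {poly C}).
Hypothesis A_neq0 : forall z : C, `|z| <= 1 -> A.[z] != 0.

(** Factorization normalized at 0, which involves no leading coefficient: it
    stays meaningful when the degree drops in a limit. *)
Lemma horner_normalized : exists2 r : seq C,
  (size r < size A)%N /\ {in r, forall x, 1 < `|x|} &
  forall z, A.[z] = A.[0] * \prod_(x <- r) (1 - z / x).
Proof.
have nzA0 : A.[0] != 0 by apply: A_neq0; rewrite normr0 ler01.
have nzA : A != 0 by apply: contra_neq nzA0 => ->; rewrite horner0.
have [r Ar] := closed_field_poly_normal A.
have nzl : lead_coef A != 0 by rewrite lead_coef_eq0.
have sr : size A = (size r).+1 by rewrite {1}Ar size_scale // size_prod_XsubC.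
have r_gt1 : {in r, forall x, 1 < `|x|}.
  move=> x xr; rewrite real_ltNge ?real1 ?normr_real //; apply/negP => /A_neq0.
  by rewrite -[_ == 0]/(root A x) Ar rootZ // root_prod_XsubC xr.
exists r; first by rewrite sr.
move=> z; rewrite {1 2}Ar !hornerZ -mulrA; congr (_ * _).
rewrite !horner_prod -big_split /= big_seq [RHS]big_seq; apply: eq_bigr => x xr.
have nzx : x != 0 by rewrite -normr_gt0 (lt_trans ltr01) ?r_gt1.
rewrite !hornerXsubC sub0r mulrBr mulr1 mulrCA mulNr mulfV // mulrN1.
by rewrite opprK addrC.
Qed.

(** When |r| > 1, the modulus of 1 - z/r is at least 1 - |z| and at most 1 +
    |z|. *)
Lemma norm_horner_bounds n (z : C) : (size A <= n.+1)%N -> `|z| <= 1 ->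
  `|A.[0]| * (1 - `|z|) ^+ n <= `|A.[z]| <= `|A.[0]| * (1 + `|z|) ^+ n.
Proof.
move=> sA z1; have [r [sr r_gt1] Ar] := horner_normalized.
have le_rn : (size r <= n)%N by rewrite -ltnS (leq_trans sr).
have zx x : x \in r -> `|z / x| <= `|z|.
  move=> /r_gt1 x1; rewrite normf_div ler_pdivrMr ?(lt_trans ltr01) //.
  by rewrite ler_peMr ?normr_ge0 ?ltW.
have cst (c : C) : c ^+ size r = \prod_(x <- r) c.
  by rewrite big_const_seq count_predT -Monoid.iteropE.
rewrite (Ar z) normrM normr_prod.
have [d0 d1] : 0 <= 1 - `|z| /\ 1 - `|z| <= 1.
  by rewrite subr_ge0 z1 gerBl normr_ge0.
apply/andP; split; apply: ler_wpM2l => //.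
  apply: (@le_trans _ _ ((1 - `|z|) ^+ size r)); first exact: ler_wiXn2l.
  rewrite cst big_seq [leRHS]big_seq; apply: ler_prod => x /zx le_zx.
  rewrite d0 /=; apply: le_trans (lerB_dist _ _).
  by rewrite normr1 lerD2l lerN2.
apply: (@le_trans _ _ ((1 + `|z|) ^+ size r)).
  rewrite cst big_seq [leRHS]big_seq; apply: ler_prod => x /zx le_zx.
  rewrite normr_ge0 /=; apply: le_trans (ler_normB _ _) _.
  by rewrite normr1 lerD2l.
by apply: ler_weXn2l; rewrite // lerDl.
Qed.

(** The factorization gives the explicit bound |A(0)| prod (1 - 1/|r|), which
    replaces a compactness argument. *)
Lemma norm_horner_lbound :
  exists2 d : C, 0 < d & forall z, `|z| <= 1 -> d <= `|A.[z]|.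
Proof.
have [r [sr r_gt1] Ar] := horner_normalized.
exists (`|A.[0]| * \prod_(x <- r) (1 - `|x|^-1)).
  rewrite mulr_gt0 ?normr_gt0 ?A_neq0 ?normr0 ?ler01 //.
  rewrite big_seq; apply: prodr_gt0 => x xr;
    rewrite subr_gt0 invf_lt1 ?r_gt1 //.
  by rewrite (lt_trans ltr01) ?r_gt1.
move=> z z1; rewrite (Ar z) normrM normr_prod; apply: ler_wpM2l => //.
rewrite big_seq [leRHS]big_seq; apply: ler_prod => x xr.
have x0 : 0 < `|x| by rewrite (lt_trans ltr01) ?r_gt1.
rewrite subr_ge0 invf_le1 // ltW ?r_gt1 //=.
apply: le_trans (lerB_dist _ _); rewrite normr1 lerD2l lerN2 normf_div.
by rewrite ler_pdivrMr // mulVf // gt_eqF.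
Qed.
End ZeroFreeBounds.

(** * The closure and the interior of the locally univalent polynomials *)

Section Closure.
Variables (R : realType) (n : nat).
Implicit Types (a b : 'rV[R]_n.+1) (z : R[i]).
Local Notation "x %:C" := (real_complex R x) (format "x %:C").

Definition cderiv a : {poly R[i]} := map_poly (real_complex R) (poly_of a)^`().

Lemma size_poly_of a : (size (poly_of a) <= n.+2)%N.
Proof.
apply: leq_trans (size_sum _ _ _) _; apply/bigmax_leqP => i _.
by apply: leq_trans (size_scale_leq _ _) _; rewrite size_polyXn ltnS.
Qed.

Lemma size_cderiv a : (size (cderiv a) <= n.+1)%N.
Proof.
rewrite size_map_poly; have [->|nz] := eqVneq (poly_of a) 0.
  by rewrite deriv0 size_poly0.
by rewrite -ltnS (leq_trans (lt_size_deriv nz)) // size_poly_of.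
Qed.

Lemma horner_cderiv a z :
  (cderiv a).[z] = \sum_(i < n.+1) (a 0 i * i.+1%:R)%:C * z ^+ i.
Proof.
rewrite (horner_coef_wide _ (size_cderiv a)); apply: eq_bigr => i _.
by rewrite coef_map coef_deriv_poly_of.
Qed.

Lemma cderiv_at0 a : (cderiv a).[0] = (a 0 ord0)%:C.
Proof. by rewrite horner_coef0 coef_map (coef_deriv_poly_of a ord0) mulr1. Qed.

Lemma poly_of0 a : (poly_of a)`_0 = 0.
Proof.
by rewrite coef_sum big1 // => i _; rewrite coefZ coefXn mulr0.
Qed.

Lemma poly_of1 a : (poly_of a)`_1 = a 0 ord0.
Proof.
by have := coef_deriv_poly_of a ord0; rewrite coef_deriv mulr1.
Qed.

Lemma norm_real_complex (x : R) : `|x%:C| = `|x|%:C.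
Proof. by rewrite normc_def /= expr0n addr0 sqrtr_sqr. Qed.

Let K : R := \sum_(i < n.+1) i.+1%:R.

Let K_ge0 : 0 <= K. Proof. exact: sumr_ge0. Qed.

Lemma cderiv_perturb a b (e : R) z :
  (forall i, `|a 0 i - b 0 i| <= e) -> `|z| <= 1 ->
  `|(cderiv a).[z] - (cderiv b).[z]| <= (e * K)%:C.
Proof.
move=> ab z1; rewrite !horner_cderiv -sumrB.
apply: le_trans (ler_norm_sum _ _ _) _.
rewrite mulr_sumr rmorph_sum; apply: ler_sum => i _ /=.
rewrite -mulrBl -rmorphB -mulrBl normrM norm_real_complex normrM.
rewrite (ger0_norm (ler0n _ i.+1)) -[leRHS]mulr1.
apply: ler_pM => //; first by rewrite ler0c mulr_ge0.
  by rewrite lecR; apply: ler_wpM2r.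
by rewrite normrX exprn_ile1.
Qed.

Lemma closure_Ploc_near a (e : R) : closure (Ploc R n.+1) a -> 0 < e ->
  exists2 b, Ploc R n.+1 b & forall i, `|a 0 i - b 0 i| <= e.
Proof.
move=> cl_a e0; have [b [Pb ab]] := cl_a _ (nbhsx_ballx a e e0).
exists b => // i; apply: ltW; exact: (ab.2 0 i).
Qed.

(** The union over the degrees j absorbs the condition on the size. *)
Lemma PlocP b : Ploc R n.+1 b <->
  0 < b 0 ord0 /\ (forall z, `|z| <= 1 -> (cderiv b).[z] != 0).
Proof.
split=> [[j _ [_ _ + nz]]|[b0 nz]]; first by rewrite poly_of1.
have nz1 : (1 < size (poly_of b))%N.
  by rewrite ltnNge; apply/negP => /leq_sizeP/(_ 1%N isT)/eqP;
    rewrite poly_of1 gt_eqF.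
exists (size (poly_of b)).-1; last first.
  by split; rewrite ?poly_of0 ?poly_of1 //; lia.
by have := size_poly_of b; move: nz1 => /=; lia.
Qed.

(** A perturbation smaller than a lower bound of the modulus on the disk
    creates no zero. It may raise the degree, but the set is a union over all
    degrees up to n + 1. *)
Lemma interior_Ploc a : 0 < a 0 ord0 ->
  (forall z, `|z| <= 1 -> (cderiv a).[z] != 0) -> (Ploc R n.+1)^° a.
Proof.
move=> a0 nz; have [d d0 dA] := norm_horner_lbound nz.
have dE : d = (complex.Re d)%:C by rewrite RRe_real // gtr0_real.
have d'0 : 0 < complex.Re d by move: d0; rewrite dE ltcR.
(* The first bound keeps b_1 positive, the second one gives e K < d. *)
pose e : R := Num.min (a 0 ord0) (complex.Re d / (K + 1)).
have e0 : 0 < e by rewrite lt_min a0 divr_gt0 // ltr_wpDl.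
have ed : e * K < complex.Re d.
  rewrite (@le_lt_trans _ _ (complex.Re d / (K + 1) * K)) //.
    by rewrite ler_wpM2r // ge_min lexx orbT.
  by rewrite -mulrA gtr_pMr // mulrC ltr_pdivrMr ?mul1r ?ltrDl ?ltr_wpDl.
apply/nbhs_ballP; exists e => //= b ab; apply/PlocP; split.
  have := ab.2 0 ord0; rewrite /ball /= => /ltr_normlP[_ h].
  by have : e <= a 0 ord0; [rewrite ge_min lexx|lra].
move=> z z1; apply: contraTneq (dA z z1) => bz.
rewrite -real_ltNge ?normr_real ?gtr0_real //.
apply: le_lt_trans (_ : (e * K)%:C < d); last by rewrite dE ltcR.
rewrite -[(cderiv a).[z]]subr0 -bz; apply: cderiv_perturb => // i.
by apply: ltW; apply: ab.2.
Qed.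

Lemma Ploc_bounds b z : Ploc R n.+1 b -> `|z| <= 1 ->
  (b 0 ord0)%:C * (1 - `|z|) ^+ n <= `|(cderiv b).[z]|
    <= (b 0 ord0)%:C * (1 + `|z|) ^+ n.
Proof.
move=> /PlocP[b0 nz] z1; have := norm_horner_bounds nz (size_cderiv b) z1.
by rewrite cderiv_at0 norm_real_complex gtr0_norm.
Qed.

Lemma horner_cderiv_real a (x : R) :
  (cderiv a).[x%:C] = ((poly_of a)^`().[x])%:C.
Proof. by rewrite horner_map. Qed.

(** Nearby points b of the set have b_1 small and positive, so the upper bound
    of [Ploc_bounds] at z = 1 forces the limit value to vanish. *)
Lemma closure_Ploc_le0 a : closure (Ploc R n.+1) a -> a 0 ord0 <= 0 ->
  (poly_of a)^`().[1] = 0.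
Proof.
move=> cl_a a0; apply/normr0_eq0/le_anti; rewrite normr_ge0 andbT.
apply/ler_addgt0Pl => e e0; rewrite addr0.
(* 2 ^+ n comes from the upper bound at |z| = 1, K from the perturbation. *)
pose L : R := 2 ^+ n + K.
have L0 : 0 < L by rewrite ltr_wpDr // exprn_gt0.
have [b Pb ab] := closure_Ploc_near cl_a (divr_gt0 e0 L0).
have norm1 : `|1 : R[i]| <= 1 by rewrite normr1.
have /andP[_] := Ploc_bounds Pb norm1; have := cderiv_perturb ab norm1.
rewrite normr1 -[1 + 1]/(2%:R) -(rmorph1 (real_complex R)) !horner_cderiv_real.
rewrite -(rmorph_nat (real_complex R)) -rmorphXn -rmorphM -rmorphB.
rewrite !norm_real_complex !lecR -/K => ab1 b1.
have b0 : b 0 ord0 <= e / L.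
  by have := ab ord0; rewrite ler_norml => /andP[]; lra.
have : e = e / L * 2 ^+ n + e / L * K by rewrite -mulrDr divfK // gt_eqF.
have := ler_wpM2r (exprn_ge0 n (ler0n R 2)) b0.
have := ler_normD
  ((poly_of a)^`().[1] - (poly_of b)^`().[1]) (poly_of b)^`().[1].
by rewrite subrK; lra.
Qed.

(** A substitute for the theorem of Hurwitz: the lower bound of [Ploc_bounds]
    passes to the limit, and it is positive when a_1 > 0 and |z| < 1. *)
Lemma closure_Ploc_disk a z : closure (Ploc R n.+1) a -> 0 < a 0 ord0 ->
  `|z| < 1 -> (cderiv a).[z] != 0.
Proof.
move=> cl_a a0 z1; apply/eqP => az.
have [t tE] : exists t : R, (1 - `|z|) ^+ n = t%:C.
  exists (complex.Re ((1 - `|z|) ^+ n)).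
  by rewrite RRe_real // rpredX // rpredB ?real1 ?normr_real.
have t0 : 0 < t.
  by have : 0 < (1 - `|z|) ^+ n by [rewrite exprn_gt0 // subr_gt0];
    rewrite tE ltcR.
have Kt0 : 0 < K + t by rewrite ltr_wpDl.
(* For a point b within e, the bounds give (a_1 - e) t <= b_1 t <= e K,
   that is a_1 t <= e (K + t); this e makes the right-hand side a_1 t / 2. *)
pose e := a 0 ord0 * t / (2 * (K + t)).
have e0 : 0 < e by rewrite divr_gt0 ?mulr_gt0.
have [b Pb ab] := closure_Ploc_near cl_a e0.
have := cderiv_perturb ab (ltW z1); rewrite az sub0r normrN => bz.
have /andP[+ _] := Ploc_bounds Pb (ltW z1).
rewrite tE -rmorphM => /le_trans/(_ bz); rewrite lecR -/K => le_bt.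
have b0 : a 0 ord0 - e <= b 0 ord0.
  by have := ab ord0; rewrite ler_norml => /andP[]; lra.
have := ler_wpM2r (ltW t0) b0.
have : e * (K + t) = a 0 ord0 * t / 2.
  by rewrite /e invfM mulrA -mulrA mulVf ?mulr1 // gt_eqF.
have : 0 < a 0 ord0 * t by rewrite mulr_gt0.
lra.
Qed.
End Closure.

(** The conjugate of a root on the unit circle is a root and its inverse, so a
    non-real one yields a quadratic factor with reciprocal roots. *)
Lemma conj_root_recip (R : realType) (a : {poly R}) (z : R[i]) :
  root (map_poly (real_complex R) a) z -> `|z| = 1 ->
  [\/ a.[1] = 0, a.[-1] = 0 |
      exists s G, map_poly (real_complex R) a = recip_mult s G].
Proof.
move=> az z1; have zJ : z * conjc z = 1 by rewrite -sqr_normc z1 expr1n.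
have azJ : root (map_poly (real_complex R) a) (conjc z).
  rewrite -complex_root_conj.
  rewrite (_ : map_poly _ _ = map_poly (real_complex R) a) //.
  by apply/polyP => i; rewrite !coef_map; apply: conjc_real.
have [zr|zJz] := eqVneq (conjc z) z.
  have : (z - 1) * (z + 1) = 0 by rewrite -subr_sqr expr1n expr2 -{2}zr zJ
    subrr.
  move=> /eqP; rewrite mulf_eq0 subr_eq0 addr_eq0 => /orP[]/eqP zE.
    constructor 1; apply: (@complexI R).
    by move/rootP: az; rewrite zE -(rmorph1 (real_complex R)) horner_map
      rmorph0.
  constructor 2; apply: (@complexI R).
  by move/rootP: az; rewrite zE -(rmorphN1 (real_complex R)) horner_map rmorph0.
constructor 3; move/factor_theorem: az azJ => [q ->].
rewrite rootM root_XsubC (negPf zJz) orbF => /factor_theorem[G ->].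
exists (z + conjc z), G; rewrite /recip_mult -mulrA mulrC; congr (_ * G).
rewrite -mul_polyC -polyC1 -zJ polyCM polyCD.
move: z%:P (conjc z)%:P 'X => u w X; ring.
Qed.

(** * The boundary *)

Lemma boundary_Ploc (R : realType) (k : nat) (n_ge3 : (3 <= k.+3)%N)
    (V : {mpoly R[k.+3]}) (HV : is_V (m := k.+2) V) :
  boundary (Ploc R k.+3) `<=`
    zero_set (Pi_plus R k.+3) `|` zero_set (Pi_minus R k.+3)
    `|` zero_set (surfaceA n_ge3 V).
Proof.
move=> a [cl_a int_a].
have [a0|a0] := ltP 0 (a 0 ord0); last first.
  by left; left; apply/zero_Pi_plus/closure_Ploc_le0.
have [z [z1 az]] : exists z : R[i], `|z| <= 1 /\ root (cderiv a) z.
  apply: contrapT => no_root; apply: int_a; apply: interior_Ploc => // z z1.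
  by apply/negP => az; apply: no_root; exists z.
have z_eq1 : `|z| = 1.
  apply/le_anti; rewrite z1 real_leNgt ?real1 ?normr_real //.
  by apply/negP => /(closure_Ploc_disk cl_a a0)/negP.
have [?|?|[s [G aE]]] := conj_root_recip az z_eq1.
- by left; left; apply/zero_Pi_plus.
- by left; right; apply/zero_Pi_minus.
right; apply: (zero_surface_recip n_ge3 HV aE).
have := size_cderiv a; rewrite /cderiv aE; have [->|nzG] := eqVneq G 0.
  by rewrite size_poly0.
have [sQ lQ] := recip_quadratic s.
by rewrite /recip_mult mulrC size_Mmonic ?sQ ?addn3 //; apply/monicP.
Qed.

Theorem theorem3 (R : realType) (n : nat) (n_ge3 : (3 <= n)%N) :
  exists V : {mpoly R[n.-1.+1]},
    unique (@is_V R n.-1) V /\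
    [/\ irreducible_of_order 1 (Pi_plus R n),
        irreducible_of_order 1 (Pi_minus R n),
        irreducible_of_order (n - 2) (surfaceA n_ge3 V) &
        boundary (Ploc R n) `<=`
          zero_set (Pi_plus R n) `|` zero_set (Pi_minus R n)
          `|` zero_set (surfaceA n_ge3 V)].
Proof.
case: n n_ge3 => [|[|[|k]]] // n_ge3.
have [V HV hV] := is_V_exists R k.+1.
exists V; split; first by split=> // W; apply: is_V_unique.
split.
- by apply: (@linear_form_irreducible R _ _ ord0); rewrite oner_eq0.
- by apply: (@linear_form_irreducible R _ _ ord0); rewrite expr0 mul1r oner_eq0.
- exact: surface_irreducible.
- exact: boundary_Ploc.
Qed.
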